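(* Let $K$ be a compact line. Then $C(K)$ has the Sobczyk property: every closed subspace of $C(K)$ that is isomorphic (linearly homeomorphic) to $c_0$ is complemented in $C(K)$.
   Context: A compact line is a (nonempty) linearly ordered set which is compact in the order topology. $C(K)$ denotes the Banach space of continuous real-valued functions on $K$ with the supremum norm. A closed subspace of a Banach space is complemented if it is the range of a bounded linear projection. *)

(* Defs.v *)
From HB Require Import structures.
From mathcomp Require Import all_boot all_order all_algebra.
From mathcomp Require Import all_classical all_reals all_analysis.

Set Implicit Arguments.
Unset Strict Implicit.
Unset Printing Implicit Defensive.

Import Order.TTheory GRing.Theory Num.Theory.
Import numFieldNormedType.Exports.

Local Open Scope classical_set_scope.
Local Open Scope ring_scope.

HB.mixin Record Topological_isCompact T & Topological T := {
  compact_setT : compact [set: T]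
}.

#[short(type="compactTopologicalType")]
HB.structure Definition CompactTopological :=
  { T of Topological T & Topological_isCompact T }.

HB.mixin Record isNonempty (T : Type) := {
  setT_nonempty : [set: T] !=set0
}.

#[short(type="compactLineType")]
HB.structure Definition CompactLine d :=
  { T of OrderTopological d T & Topological_isCompact T & isNonempty T }.

Section sup_norm.
Context {R : realType} {T : Type}.
Implicit Types f g : T -> R.

Definition sup_norm f : R := sup (range (fun x => `|f x|)).

Let bounded f := has_ubound (range (fun x => `|f x|)).

Lemma sup_norm_ub f x : bounded f -> `|f x| <= sup_norm f.
Proof. by move=> bf; apply: ub_le_sup => //; exists x. Qed.

Lemma sup_norm_le f (M : R) :
  0 <= M -> (forall x, `|f x| <= M) -> sup_norm f <= M.
Proof.
move=> M0 fM; have [/eqP e|/set0P ne] := boolP (range (fun x => `|f x|) == set0).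
  by rewrite /sup_norm e sup0.
by apply: ge_sup => // _ [x _ <-].
Qed.

Lemma sup_norm_ge0 f : 0 <= sup_norm f.
Proof.
have [sf|sf] := pselect (has_sup (range (fun x => `|f x|))); last first.
  by rewrite /sup_norm sup_out.
have [[_ [x _ _]] ub] := sf; exact: le_trans (sup_norm_ub x ub).
Qed.

Lemma sup_normD f g : bounded f -> bounded g ->
  sup_norm (fun x => f x + g x) <= sup_norm f + sup_norm g.
Proof.
move=> bf bg; apply: sup_norm_le => [|x]; first by rewrite addr_ge0 ?sup_norm_ge0.
by rewrite (le_trans (ler_normD _ _))// lerD ?sup_norm_ub.
Qed.

Lemma sup_normZ (l : R) f : bounded f ->
  sup_norm (fun x => l * f x) = `|l| * sup_norm f.
Proof.
move=> bf; apply/eqP; rewrite eq_le; apply/andP; split.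
  apply: sup_norm_le => [|x]; first by rewrite mulr_ge0 ?sup_norm_ge0.
  by rewrite normrM ler_wpM2l ?sup_norm_ub.
have [->|l0] := eqVneq l 0; first by rewrite normr0 mul0r sup_norm_ge0.
rewrite -ler_pdivlMl ?normr_gt0//.
apply: sup_norm_le => [|x]; first by rewrite mulr_ge0 ?sup_norm_ge0 ?invr_ge0.
rewrite ler_pdivlMl ?normr_gt0// -normrM.
apply: (@sup_norm_ub (fun x => l * f x)).
have [M fM] := bf; exists (`|l| * M) => _ [y _ <-].
by rewrite normrM ler_wpM2l//; apply: fM; exists y.
Qed.

Lemma sup_norm_eq0 f : bounded f -> sup_norm f = 0 -> forall x, f x = 0.
Proof.
move=> bf f0 x; apply/eqP; rewrite -normr_le0 -f0; exact: sup_norm_ub.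
Qed.

End sup_norm.

(* [continuousType K R] already carries several competing topologies in the
   library; this alias is the one equipped with the norm topology. *)
Definition contfun (R : realType) (K : compactTopologicalType) : Type :=
  continuousType K R.

Section contfun.
Context {R : realType} {K : compactTopologicalType}.

Definition contfun_pred : {pred K -> R} := fun f => `[< continuous f >].

Definition contfun_val (f : contfun R K) : K -> R := (f : continuousType K R).

Lemma contfun_valP (f : contfun R K) : contfun_pred (contfun_val f).
Proof. by apply/asboolP; exact: (@cts_fun _ _ (f : continuousType K R)). Qed.

Definition contfun_Sub (f : K -> R) (cf : contfun_pred f) : contfun R K :=
  (mkcts (asboolW cf) : continuousType K R).

Lemma contfun_rect (P : contfun R K -> Type) :
  (forall f (cf : contfun_pred f), P (contfun_Sub cf)) -> forall u, P u.
Proof.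
move=> H u; have := H _ (contfun_valP u).
by have -> : contfun_Sub (contfun_valP u) = u by apply/continuousEP.
Qed.

HB.instance Definition _ := Choice.copy (contfun R K) (continuousType K R).
HB.instance Definition _ :=
  @isSub.Build (K -> R) contfun_pred (contfun R K) contfun_val contfun_Sub
    contfun_rect (fun _ _ => erefl).

Lemma contfun_submod_closed : submod_closed contfun_pred.
Proof.
split; first by apply/asboolP => x; exact: cvg_cst.
move=> a f g /asboolP cf /asboolP cg; apply/asboolP => x.
apply: cvgD; last exact: cg.
by apply: cvgZr; exact: cf.
Qed.

HB.instance Definition _ :=
  GRing.isSubmodClosed.Build R (K -> R) contfun_pred contfun_submod_closed.
HB.instance Definition _ := [SubChoice_isSubLmodule of contfun R K by <:].

Lemma contfun_bounded (f : contfun R K) :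
  has_ubound (range (fun x => `|contfun_val f x|)).
Proof.
have cf : continuous (contfun_val f) by apply/asboolP; exact: contfun_valP.
have /compact_bounded[M [_ hM]] :
    compact (contfun_val f @` [set: K]).
  by apply: continuous_compact;
    [exact: continuous_subspaceT | exact: compact_setT].
exists (M + 1) => _ [x _ <-].
by apply: (hM (M + 1)); [rewrite ltrDl | exists x].
Qed.

Let norm (f : contfun R K) : R := sup_norm (contfun_val f).

Let ler_normD (f g : contfun R K) : norm (f + g) <= norm f + norm g.
Proof. exact: sup_normD (contfun_bounded f) (contfun_bounded g). Qed.

Let normZ (l : R) (f : contfun R K) : norm (l *: f) = `|l| * norm f.
Proof. exact: sup_normZ (contfun_bounded f). Qed.

Let norm_eq0 (f : contfun R K) : norm f = 0 -> f = 0.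
Proof.
by move=> f0; apply: val_inj; apply/funext; exact: sup_norm_eq0 (contfun_bounded f) f0.
Qed.

HB.instance Definition _ :=
  Lmodule_isNormed.Build R (contfun R K) ler_normD normZ norm_eq0.

Lemma contfun_normE (f : contfun R K) :
  `|f| = sup (range (fun x => `|contfun_val f x|)).
Proof. by []. Qed.

End contfun.

Section c0space.
Context {R : realType}.

Definition c0space_pred : {pred nat -> R} := fun u => `[< u @ \oo --> (0 : R) >].

Record c0space := C0Space { c0space_val : nat -> R ; _ : c0space_pred c0space_val }.

HB.instance Definition _ := [isSub for c0space_val].
HB.instance Definition _ := [Choice of c0space by <:].

Lemma c0space_submod_closed : submod_closed c0space_pred.
Proof.
split; first by apply/asboolP; exact: cvg_cst.
move=> a u v /asboolP cu /asboolP cv; apply/asboolP.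
have : (fun n => a *: u n + v n) @ \oo --> a *: (0 : R) + (0 : R).
  by apply: cvgD => //; exact: cvgZr.
by rewrite scaler0 addr0.
Qed.

HB.instance Definition _ :=
  GRing.isSubmodClosed.Build R (nat -> R) c0space_pred c0space_submod_closed.
HB.instance Definition _ := [SubChoice_isSubLmodule of c0space by <:].

Lemma c0space_bounded (u : c0space) : has_ubound (range (fun n => `|c0space_val u n|)).
Proof.
have /asboolP cu : c0space_pred (c0space_val u) by case: u.
have /cvg_seq_bounded[M [_ hM]] : cvgn (c0space_val u) by apply/cvg_ex; exists 0.
exists (M + 1) => _ [n _ <-].
by apply: (hM (M + 1)) => //; rewrite ltrDl.
Qed.

Let norm (u : c0space) : R := sup_norm (c0space_val u).

Let ler_normD (u v : c0space) : norm (u + v) <= norm u + norm v.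
Proof. exact: sup_normD (c0space_bounded u) (c0space_bounded v). Qed.

Let normZ (l : R) (u : c0space) : norm (l *: u) = `|l| * norm u.
Proof. exact: sup_normZ (c0space_bounded u). Qed.

Let norm_eq0 (u : c0space) : norm u = 0 -> u = 0.
Proof.
by move=> u0; apply: val_inj; apply/funext; exact: sup_norm_eq0 (c0space_bounded u) u0.
Qed.

HB.instance Definition _ := Lmodule_isNormed.Build R c0space ler_normD normZ norm_eq0.

Lemma c0space_normE (u : c0space) : `|u| = sup (range (fun n => `|c0space_val u n|)).
Proof. by []. Qed.

End c0space.
Arguments c0space R : clear implicits.

Section complemented.
Context {R : realType}.

Definition closed_subspace (X : normedModType R) (Y : set X) :=
  submod_closed (mem Y) /\ closed Y.

(* [Y] has the topology induced by [X]; linearity of the inverse [g] on [Y]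
   follows from that of [f]. *)
Definition isomorphic_to_subspace (V X : normedModType R) (Y : set X) :=
  exists (f : {linear V -> X}) (g : X -> V),
    [/\ range f = Y, cancel f g, continuous f & {within Y, continuous g}].

Definition bounded_linear (V W : normedModType R) (f : {linear V -> W}) :=
  exists M : R, forall x, `|f x| <= M * `|x|.

Definition complemented (X : normedModType R) (Y : set X) :=
  exists P : {linear X -> X},
    [/\ bounded_linear P, forall x, P (P x) = P x & range P = Y].

Definition sobczyk_property (X : normedModType R) :=
  forall Y : set X, closed_subspace Y ->
    isomorphic_to_subspace (c0space R) Y -> complemented Y.

End complemented.

(* Main.v *)
Require Import Defs.
From HB Require Import structures.
From mathcomp Require Import all_boot all_order all_algebra.
From mathcomp Require Import all_classical all_reals all_analysis.
From mathcomp Require Import ring lra.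

(** Let [T : c0 -> C(K)] be an isomorphism onto the given subspace and let
    [f_m = T e_m], so that [sum_m |f_m x| <= C] for all [x]. Fix a small [eps] and
    derive a closed set [H] by keeping the points all of whose neighbourhoods
    contain, for every [N], points of [H] at which some partial sum of
    [sum_(m >= N) |f_m|] exceeds [eps]. Each derivation lowers the bound on
    [sum_m |f_m|] by [eps], so that, starting from [K], finitely many derivations
    [H_0, H_1, ...] reach the empty set.

    This is where the order enters: for a closed nonempty [F] in a compact line
    there is a (usually discontinuous) map [p : K -> F] which is the identity on
    [F] and is continuous at the points of [F]. Taking [F = H_(i+1)], the functionals
    [g |-> g x - g (p x)], over those [x] in [H_i] where the tail of order [k]
    exceeds [eps], tend to 0 pointwise, uniformly in [x], as [k] grows. Their
    suprema are seminorms [p_k] tending to 0 pointwise, and telescoping along the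
    [H_i] shows that [p_k (T a)] is equivalent to [|a|] when the first [k]
    coordinates of [a] vanish.

    A finite-net argument on the first [k] coordinates then gives
    [|a_n| <= D p_k (T a) + delta |a|] for all [a] and all large [n]. With [k] growing
    slowly with [n], the Hahn-Banach theorem extends the coordinates of
    [c0] to functionals [nu_n] on [C(K)] that tend to 0 pointwise, and
    [g |-> T (nu_n g)_n] is the required projection. *)

Set Implicit Arguments.
Unset Strict Implicit.
Unset Printing Implicit Defensive.

Import Order.TTheory GRing.Theory Num.Theory.
Import numFieldNormedType.Exports.

Local Open Scope classical_set_scope.
Local Open Scope ring_scope.

(** * The Hahn-Banach theorem *)

Lemma seminorm_ge0 (R : realType) (V : lmodType R) (q : V -> R) :
  (forall x y, q (x + y) <= q x + q y) ->
  (forall (t : R) x, q (t *: x) = `|t| * q x) -> forall x, 0 <= q x.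
Proof.
move=> qD qZ x; have := qD x (-1 *: x).
by rewrite qZ scaleN1r subrr normrN1 mul1r -(scale0r 0) qZ normr0 mul0r; lra.
Qed.

Section hahn_banach.
Context {R : realType} {V : lmodType R} (p : V -> R).
Hypothesis p_subadd : forall u v, p (u + v) <= p u + p v.
Hypothesis p_homog : forall (a : R) v, 0 <= a -> p (a *: v) = a * p v.

(** A partial functional is encoded by its graph. Domination forces single-valuedness: two values at
    one vector differ by a value at 0, which [p 0 = 0] bounds on both sides. *)
Let dominated_graph (G : set (V * R)) :=
  (forall (a : R) x y, G x -> G y -> G (a *: x.1 + y.1, a * x.2 + y.2)) /\
  (forall x, G x -> x.2 <= p x.1).

(** Domination on multiples of [v0] bounds the new value [s] from below by [x.2 - p (x.1 - v0)] and
    from above by [p (y.1 + v0) - y.2]. Subadditivity puts every lower bound below every upper one,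
    so the supremum of the lower bounds works. *)
Let graph_extend (G : set (V * R)) (v0 : V) : G (0, 0) -> dominated_graph G ->
  exists s, dominated_graph
    [set z | exists x a, G x /\ z = (x.1 + a *: v0, x.2 + a * s)].
Proof.
move=> G0 [lG dG].
have G2 x y : G x -> G y -> x.2 - p (x.1 - v0) <= p (y.1 + v0) - y.2.
  move=> Gx Gy; have := dG _ (lG 1 _ _ Gx Gy); rewrite /= scale1r mul1r => h.
  have := p_subadd (x.1 - v0) (y.1 + v0).
  by rewrite addrACA addNr addr0 => h'; lra.
pose A := [set r | exists2 x, G x & r = x.2 - p (x.1 - v0)].
have supA : has_sup A.
  split; first by exists (0 - p (0 - v0)); exists (0, 0).
  by exists (p (0 + v0) - 0) => _ [x Gx ->]; exact: (G2 x (0, 0)).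
pose s := sup A.
have As x : G x -> x.2 - p (x.1 - v0) <= s.
  by move=> Gx; apply: ub_le_sup; [case: supA|exists x].
have sA y : G y -> s <= p (y.1 + v0) - y.2.
  by move=> Gy; apply: ge_sup; [case: supA|move=> _ [x Gx ->]; exact: G2].
have GZ a x : G x -> G (a *: x.1, a * x.2).
  by move=> Gx; have := lG a _ _ Gx G0; rewrite /= !addr0.
exists s; split=> [a _ _ [x [b [Gx ->]]] [y [c [Gy ->]]]|_ [x [a [Gx ->]]]] /=.
  exists (a *: x.1 + y.1, a * x.2 + y.2), (a * b + c); split; first exact: lG.
  by rewrite /= scalerDr scalerA scalerDl addrACA; congr pair; ring.
have [a0|a0|->] := ltgtP a 0; last by rewrite scale0r mul0r !addr0; exact: dG.
- have b0 : 0 < - a by rewrite oppr_gt0.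
  have := As _ (GZ (- a)^-1 _ Gx); rewrite -(ler_pM2l b0) /= mulrBr.
  rewrite mulrA mulfV ?gt_eqF// mul1r -(p_homog _ (ltW b0)).
  rewrite scalerBr scalerA mulfV ?gt_eqF// scale1r scaleNr opprK; lra.
- have := sA _ (GZ a^-1 _ Gx); rewrite -(ler_pM2l a0) /= mulrBr.
  rewrite mulrA mulfV ?gt_eqF// mul1r -(p_homog _ (ltW a0)).
  by rewrite scalerDr scalerA mulfV ?gt_eqF// scale1r; lra.
Qed.

Theorem hahn_banach (W : lmodType R) (T : {linear W -> V}) (phi : {scalar W}) :
  (forall w, phi w <= p (T w)) ->
  exists g : {scalar V}, (forall w, g (T w) = phi w) /\ (forall v, g v <= p v).
Proof.
move=> phip; pose G0 := [set z | exists w, z = (T w, phi w)].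
(* Adjoining [G0] inside the predicate lets the union of the empty chain satisfy it too. *)
pose P (G : set (V * R)) := dominated_graph (G `|` G0).
have dG0 : dominated_graph G0.
  split=> [a _ _ [u ->] [v ->]|_ [w ->]] //=.
  by exists (a *: u + v); rewrite !linearP.
have G00 : G0 (0, 0) by exists 0; rewrite !linear0.
have [|G [PG Gmax]] := @Zorn_bigcup _ P.
  move=> F FP Ftot; split=> [a x y|x]; last first.
    by move=> [[G FG Gx]|Gx]; [apply: (FP _ FG).2; left|exact: dG0.2].
  have aux G H z : F G -> F H -> G `<=` H -> G z -> H z by move=> _ _ + ?; exact.
  move=> [[G FG Gx]|Gx] [[H FH Hy]|Hy].
  - have [GH|HG] := Ftot _ _ FG FH.
    + have [||h|h] := (FP _ FH).1 a x y.
      * by left; exact: GH.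
      * by left.
      * by left; exists H.
      * by right.
    + have [||h|h] := (FP _ FG).1 a x y.
      * by left.
      * by left; exact: HG.
      * by left; exists G.
      * by right.
  - by have [||h|h] := (FP _ FG).1 a x y; [left|right|left; exists G|right].
  - by have [||h|h] := (FP _ FH).1 a x y; [right|left|left; exists H|right].
  - by right; exact: dG0.1.
set H := G `|` G0 in PG.
have H0 : H (0, 0) by right.
have Htot v : exists r, H (v, r).
  apply: contrapT => nv.
  have [s dH'] := graph_extend v H0 PG.
  set H' := (X in dominated_graph X) in dH'.
  have HH' : H `<=` H'.
    by move=> x Hx; exists x, 0; rewrite scale0r mul0r !addr0; case: x Hx.
  have H'v : H' (v, s).
    by exists (0, 0), 1; rewrite /= scale1r mul1r !add0r.
  apply: (Gmax H'); last first.
    rewrite /P setUidl//; apply: subset_trans HH'; exact: subsetUr.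
  split; last by move/(_ _ H'v) => Gv; apply: nv; exists s; left.
  by apply: subset_trans HH'; exact: subsetUl.
have Huniq v r s : H (v, r) -> H (v, s) -> r = s.
  suff le r' s' : H (v, r') -> H (v, s') -> r' <= s'.
    by move=> Hr Hs; apply/eqP; rewrite eq_le !le.
  move=> Hr Hs; have := PG.1 (-1) _ _ Hs (PG.1 1 _ _ Hr H0).
  move=> /PG.2 /=; rewrite scale1r !addr0 scaleN1r addNr.
  have -> : p 0 = 0 by rewrite -(scale0r 0) p_homog// mul0r.
  by rewrite mulN1r mul1r addrC subr_le0.
have [g gP] := choice Htot.
have glin : scalar g.
  by move=> a u v; exact: (Huniq _ _ _ (gP _) (PG.1 a _ _ (gP u) (gP v))).
pose gL := GRing.isLinear.Build R V R *%R g glin.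
pose g' : {scalar V} := HB.pack g gL.
exists g'; split=> [w|v]; last exact: PG.2 (gP v).
by apply: (Huniq (T w)) => //; right; exists w.
Qed.
End hahn_banach.

(** * Closed subsets of a compact line *)

Section compact_order.
Context {d} {T : orderTopologicalType d}.
Local Open Scope order_scope.
Implicit Types (A F : set T) (x y z : T).

(** The traces on [A] of the rays above points of [A] form a filter base; a cluster point lies in
    all these closed rays. *)
Lemma compact_has_max A : compact A -> A !=set0 ->
  exists2 m, A m & forall y, A y -> y <= m.
Proof.
move=> cA A0; pose G := filter_from A (fun y => A `&` [set` `[y, +oo[]).
have FG : ProperFilter G.
  apply: filter_from_proper => [|y Ay]; last by exists y; split => //=; rewrite in_itv/= lexx.
  apply: filter_from_filter => // x y Ax Ay.
  have [xy|/ltW yx] := leP x y; [exists y|exists x] => // t [At];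
    rewrite /= !in_itv/= !andbT => h; (do 2 split) => //; rewrite /= in_itv/= andbT //.
  - exact: le_trans h.
  - exact: le_trans h.
have [|m [Am /= mG]] := cA G FG; first by case: A0 => a Aa; exists a => // t [].
exists m => // y Ay; have : closed [set` `[y, +oo[] by exact: rray_closed.
move=> /(_ m); rewrite /= in_itv/= andbT; apply => B mB.
have /mG -/(_ _ mB)[t [[At yt] Bt]] : G (A `&` [set` `[y, +oo[]) by exists y.
by exists t.
Qed.

Lemma compact_has_min A : compact A -> A !=set0 ->
  exists2 m, A m & forall y, A y -> m <= y.
Proof.
move=> cA A0; pose G := filter_from A (fun y => A `&` [set` `]-oo, y]]).
have FG : ProperFilter G.
  apply: filter_from_proper => [|y Ay]; last by exists y; split => //=; rewrite in_itv/= lexx.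
  apply: filter_from_filter => // x y Ax Ay.
  have [xy|/ltW yx] := leP x y; [exists x|exists y] => // t [At];
    rewrite /= !in_itv/= => h; (do 2 split) => //; rewrite /= in_itv/= //.
  - exact: le_trans xy.
  - exact: le_trans yx.
have [|m [Am /= mG]] := cA G FG; first by case: A0 => a Aa; exists a => // t [].
exists m => // y Ay; have : closed [set` `]-oo, y]] by exact: lray_closed.
move=> /(_ m); rewrite /= in_itv/=; apply => B mB.
have /mG -/(_ _ mB)[t [[At yt] Bt]] : G (A `&` [set` `]-oo, y]]) by exists y.
by exists t.
Qed.

(* Points outside [F] go to one end of the gap of [F] containing them, on either
   side of a cut [c] which only depends on the gap. *)
Lemma closed_pointwise_retraction F : compact [set: T] -> closed F -> F !=set0 ->
  exists p : T -> T, [/\ forall x, F (p x), forall x, F x -> p x = x &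
    forall z, F z -> p x @[x --> z] --> z].
Proof.
move=> cT cF [x0 Fx0].
have cptF A : closed A -> compact A.
  by move=> cA; exact: (subclosed_compact cA cT).
pose L x := F `&` [set` `]-oo, x]]; pose U x := F `&` [set` `[x, +oo[].
pose lo x := xget x0 [set m | L x m /\ forall y, L x y -> y <= m].
pose up x := xget x0 [set m | U x m /\ forall y, U x y -> m <= y].
pose c a b := xget x0 [set t | a < t < b].
have loP x : L x !=set0 -> L x (lo x) /\ forall y, L x y -> y <= lo x.
  move=> L0; apply: (@xgetPex _ x0 [set m | L x m /\ forall y, L x y -> y <= m]).
  have [|m Lm mP] := compact_has_max (cptF (L x) _) L0; last by exists m.
  by apply: closedI => //; exact: lray_closed.
have upP x : U x !=set0 -> U x (up x) /\ forall y, U x y -> up x <= y.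
  move=> U0; apply: (@xgetPex _ x0 [set m | U x m /\ forall y, U x y -> m <= y]).
  have [|m Um mP] := compact_has_min (cptF (U x) _) U0; last by exists m.
  by apply: closedI => //; exact: rray_closed.
have cP a b t : a < t < b -> a < c a b < b.
  by move=> atb; apply: (@xgetI _ x0 [set t | a < t < b] t).
pose p x := if L x == set0 then up x else if U x == set0 then lo x else
  if x <= c (lo x) (up x) then lo x else up x.
have inL x y : F y -> y <= x -> L x y.
  by move=> Fy yx; split => //=; rewrite in_itv.
have inU x y : F y -> x <= y -> U x y.
  by move=> Fy xy; split => //=; rewrite in_itv/= xy.
have Ux x : L x = set0 -> U x !=set0.
  move=> Lx; exists x0; apply: inU => //; rewrite leNgt; apply/negP => /ltW h.
  by have := inL _ _ Fx0 h; rewrite Lx.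
have LE x y : L x y -> F y /\ y <= x by move=> [? /=]; rewrite in_itv.
have UE x y : U x y -> F y /\ x <= y by move=> [? /=]; rewrite in_itv/= andbT.
(* Besides landing in [F], [p] carries no point across a point of [F]. *)
have pP x : [/\ F (p x), forall y, F y -> y <= x -> y <= p x &
    forall y, F y -> x <= y -> p x <= y].
  rewrite /p; case: eqP => [Lx|/eqP/set0P/loP[/LE[Fl lx] lP]].
    have [/UE[Fu xu] uP] := upP _ (Ux _ Lx).
    by split=> // y Fy yx; [have := inL _ _ Fy yx; rewrite Lx|exact/uP/inU].
  case: eqP => [Ux0|/eqP/set0P/upP[/UE[Fu xu] uP]].
    by split=> // y Fy yx; [exact/lP/inL|have := inU _ _ Fy yx; rewrite Ux0].
  case: ifP => _; split=> // y Fy yx.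
  - exact/lP/inL.
  - exact: le_trans lx yx.
  - exact: le_trans yx xu.
  - exact/uP/inU.
have pF x : F (p x) by case: (pP x).
have pid x : F x -> p x = x.
  by move=> Fx; apply/eqP; rewrite eq_le; have [_ -> // ->//] := pP x.
(* Continuity from the left at [z]. If [F] meets []u, z[], any common point serves as [l]. Otherwise
   []u, z[] lies in one gap of [F] ending at [z]: the points beyond its cut go to [z], or all of
   them if no point of [F] lies to the left. *)
have pl z u : F z -> u < z -> exists2 l, l < z & forall x, l < x -> x <= z -> u < p x.
  move=> Fz uz; have [[y [Fy uy yz]]|noF] := pselect (exists y, [/\ F y, u < y & y < z]).
    by exists y => // x yx _; apply: lt_le_trans uy _; have [_ + _] := pP x; apply => //; exact: ltW.
  have noF' y : F y -> y < z -> y <= u.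
    by move=> Fy yz; rewrite leNgt; apply/negP => uy; apply: noF; exists y.
  have upE x : u < x -> x < z -> up x = z.
    move=> ux xz; have [/UE[Fu xu] uP] := upP x (ex_intro _ z (inU _ _ Fz (ltW xz))).
    apply/eqP; rewrite eq_le uP ?leNgt//=; last exact/inU/ltW.
    apply/negP => /(noF' _ Fu); rewrite leNgt => /negP; apply.
    exact: lt_le_trans xu.
  have LLE x y : u < x -> x < z -> u < y -> y < z -> L x = L y.
    move=> ux xz uy yz; apply/seteqP; split=> t /LE[Ft] tx; apply: inL => //.
      by apply: le_trans (ltW uy); apply: noF' => //; exact: le_lt_trans xz.
    by apply: le_trans (ltW ux); apply: noF' => //; exact: le_lt_trans yz.
  have [[t /andP[ut tz]]|noT] := pselect (exists t, u < t < z); last first.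
    exists u => // x ux xz; rewrite (_ : x = z) ?pid//; apply/eqP.
    by rewrite eq_le xz leNgt; apply/negP => xz'; apply: noT; exists x; rewrite ux.
  have [Lt|/set0P Lt] := eqVneq (L t) set0.
    exists u => // x ux; rewrite le_eqVlt => /predU1P[->|xz]; first by rewrite pid.
    by rewrite /p (LLE x t)// Lt eqxx upE.
  have [/LE[Fl lt] lP] := loP _ Lt.
  have lu : lo t <= u by apply: noF' => //; exact: le_lt_trans tz.
  have /andP[lc cz] : lo t < c (lo t) z < z.
    by apply: (cP _ _ t); rewrite tz andbT; exact: le_lt_trans ut.
  exists (Order.max u (c (lo t) z)); first by rewrite gt_max uz.
  move=> x; rewrite gt_max => /andP[ux cx].
  rewrite le_eqVlt => /predU1P[->|xz]; first by rewrite pid.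
  have loE : lo x = lo t by rewrite /lo (LLE x t).
  rewrite /p loE upE// (LLE x t)//; move/set0P: Lt => /negPf ->.
  rewrite leNgt cx /= ifF//; apply/eqP => Ux0.
  by have := inU _ _ Fz (ltW xz); rewrite Ux0.
have pr z v : F z -> z < v -> exists2 r, z < r & forall x, x < r -> z <= x -> p x < v.
  move=> Fz zv; have [[y [Fy yv zy]]|noF] := pselect (exists y, [/\ F y, y < v & z < y]).
    by exists y => // x yx _; apply: le_lt_trans _ yv; have [_ _ +] := pP x; apply => //; exact: ltW.
  have noF' y : F y -> z < y -> v <= y.
    by move=> Fy yz; rewrite leNgt; apply/negP => uy; apply: noF; exists y.
  have loE x : x < v -> z < x -> lo x = z.
    move=> xv zx; have [/LE[Fu xu] uP] := loP x (ex_intro _ z (inL _ _ Fz (ltW zx))).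
    apply/eqP; rewrite eq_le uP ?andbT ?leNgt//=; last exact/inL/ltW.
    apply/negP => /(noF' _ Fu); rewrite leNgt => /negP; apply.
    exact: le_lt_trans xv.
  have UUE x y : x < v -> z < x -> y < v -> z < y -> U x = U y.
    move=> ux xz uy yz; apply/seteqP; split=> t /UE[Ft] tx; apply: inU => //.
      by apply: (le_trans (ltW uy)); apply: noF' => //; exact: lt_le_trans xz tx.
    by apply: (le_trans (ltW ux)); apply: noF' => //; exact: lt_le_trans yz tx.
  have [[t /andP[zt tv]]|noT] := pselect (exists t, z < t < v); last first.
    exists v => // x ux xz; rewrite (_ : x = z) ?pid//; apply/eqP.
    by rewrite eq_le xz leNgt andbT; apply/negP => xz'; apply: noT; exists x; rewrite ux xz'.
  have Lx x : z < x -> L x <> set0.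
    by move=> /ltW/(inL _ _ Fz) + L0; rewrite L0.
  have [Ut|/set0P Ut] := eqVneq (U t) set0.
    exists v => // x xv; rewrite le_eqVlt => /predU1P[<-|zx]; first by rewrite pid.
    by rewrite /p; case: eqP => [/(Lx _ zx)//|_]; rewrite (UUE x t)// Ut eqxx loE.
  have [/UE[Fu tu] uP] := upP _ Ut.
  have lu : v <= up t by apply: noF' => //; exact: lt_le_trans tu.
  have /andP[lc cz] : z < c z (up t) < up t.
    by apply: (cP _ _ t); rewrite zt /=; exact: lt_le_trans lu.
  exists (Order.min v (c z (up t))); first by rewrite lt_min zv.
  move=> x; rewrite lt_min => /andP[xv xc].
  rewrite le_eqVlt => /predU1P[<-|zx]; first by rewrite pid.
  have upE : up x = up t by rewrite /up (UUE x t).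
  rewrite /p loE// upE (UUE x t)//; move/set0P: Ut => /negPf ->.
  by case: eqP => [/(Lx _ zx)//|_]; rewrite ltW.
exists p; split=> // z Fz.
have pl' u : u < z -> \forall x \near z, u < p x.
  move=> uz; have [l lz lP] := pl z u Fz uz.
  have : nbhs z [set` `]l, +oo[].
    by apply: open_nbhs_nbhs; split; [exact: rray_open|rewrite /= in_itv/= lz].
  apply: filterS => x; rewrite /= in_itv/= andbT => lx.
  have [xz|/ltW zx] := leP x z; first exact: lP.
  by apply: lt_le_trans uz _; have [_ + _] := pP x; apply.
have pr' v : z < v -> \forall x \near z, p x < v.
  move=> zv; have [r zr rP] := pr z v Fz zv.
  have : nbhs z [set` `]-oo, r[].
    by apply: open_nbhs_nbhs; split; [exact: lray_open|rewrite /= in_itv/= zr].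
  apply: filterS => x; rewrite /= in_itv/= => xr.
  have [zx|/ltW xz] := leP z x; first exact: rP.
  by apply: le_lt_trans _ zv; have [_ _ +] := pP x; apply.
(* Basic neighbourhoods are intervals with open ends, so the two one-sided bounds suffice. *)
move=> V; rewrite {1}itv_nbhsE => -[[i j] [+ +] ijV] /=.
rewrite in_itv/=.
have W : forall x, [set` Interval i j] (p x) -> V (p x) by move=> x; exact: ijV.
suff : itv_open_ends (Interval i j) -> z \in Interval i j ->
    \forall x \near z, p x \in Interval i j.
  move=> h ij zij; have {}zij : z \in Interval i j by rewrite in_itv.
  by apply: filterS (h ij zij) => x; exact: W.
move=> + zij; move: zij; rewrite in_itv/=.
case: i {ijV W} => [[] u|[]]; case: j => [[] v|[]] //=; rewrite ?andbT.
- move=> /andP[uz zv] _; have := pr' _ zv; have := pl' _ uz.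
  by apply: filterS2 => x ux xv; rewrite in_itv/= ux.
- by move=> uz _; apply: filterS (pl' _ uz) => x ux; rewrite in_itv/= ux.
- by move=> zv _; apply: filterS (pr' _ zv) => x ux; rewrite in_itv/= ux.
- by move=> _ _; apply: nearW => x; rewrite in_itv.
Qed.
End compact_order.

(** * Derivation of closed sets *)

Section derived_sets.
Context {R : realType} {T : compactTopologicalType} (f : nat -> T -> R) (eps : R).
Hypotheses (f_cont : forall m, continuous (f m)) (eps0 : 0 < eps).

Definition small_tail N := [set x | forall M, \sum_(N <= m < M) `|f m x| <= eps].

Definition derived (H : set T) := \bigcap_N closure (H `\` small_tail N).

Lemma small_tailS N N' : (N <= N')%N -> small_tail N `<=` small_tail N'.
Proof.
move=> NN' x Nx M; have [N'M|MN'] := leqP N' M; last by rewrite big_geq 1?ltnW// ltW.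
apply: le_trans (Nx M); rewrite [leRHS](big_cat_nat NN' N'M)/=.
by rewrite lerDr sumr_ge0.
Qed.

Lemma closed_derived H : closed (derived H).
Proof. by apply: closed_bigI => N _; exact: closed_closure. Qed.

(** If the first [M] terms exceeded [B - eps] at [x], they would do so near [x] by continuity; some
    nearby point of [H] has a tail from [M] on exceeding [eps], so its total would exceed [B]. *)
Lemma derived_sum_le H B : (forall x M, H x -> \sum_(0 <= m < M) `|f m x| <= B) ->
  forall x M, derived H x -> \sum_(0 <= m < M) `|f m x| <= B - eps.
Proof.
move=> HB x M Dx; rewrite leNgt; apply/negP => Bx.
have cS : continuous (fun y => \sum_(0 <= m < M) `|f m y|).
  apply: continuous_big => [|m _ y]; first exact: add_continuous.
  by apply: cvg_norm; exact: f_cont.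
have : \forall y \near x, B - eps < \sum_(0 <= m < M) `|f m y|.
  exact: cvgr_gt (cS x) _ Bx.
move=> /(Dx M I)[y [[Hy Ny] yB]]; apply: Ny => M'.
have [MM'|/ltnW M'M] := leqP M M'; last by rewrite big_geq// ltW.
have := HB y M' Hy; rewrite (big_cat_nat _ MM')//=; lra.
Qed.

(** By compactness: if no [N] worked, the decreasing sets of points of [A] and [H] outside
    [small_tail N] would cluster in [A], at a point of [derived H]. *)
Lemma derived_disjoint H A : closed A -> A `&` derived H `<=` set0 ->
  exists N, A `&` H `<=` small_tail N.
Proof.
move=> cA AH; apply: contrapT => noN.
pose B N := A `&` (H `\` small_tail N).
have FB : ProperFilter (filter_from setT B).
  apply: filter_from_proper => [|N _].
    apply: filter_from_filter; first by exists 0%N.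
    move=> i j _ _; exists (maxn i j) => // x [Ax [Hx Nx]].
    by split; split => //; split => // h; apply: Nx;
      apply: small_tailS h; rewrite ?leq_maxl ?leq_maxr.
  apply: contrapT => BN; apply: noN; exists N => x [Ax Hx].
  by apply: contrapT => Nx; apply: BN; exists x.
have [|x [Ax Bx]] := subclosed_compact cA compact_setT (@subsetT _ A) FB.
  by exists 0%N => // x [].
apply: (AH x); split => // N _ V xV.
have [|t [[At Ht] Vt]] := Bx (B N) V _ xV; first by exists N.
by exists t.
Qed.

End derived_sets.

(** * Seminorms on [C(K)] that tend to zero pointwise *)

Section line.
Context {R : realType} {d : Order.disp_t} {K : compactLineType d}.
Context (f : nat -> K -> R) (eps : R).
Hypothesis eps0 : 0 < eps.

(* The value [None] covers the case where [derived f eps H] is empty: there is no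
   point to move [x] to, and the last clause holds vacuously for large [N]. *)
Lemma derived_move (H : set K) : exists y : K -> option K,
  (forall x z, y x = Some z -> derived f eps H z) /\
  forall (g : K -> R) (e : R), continuous g -> 0 < e -> exists N, forall x,
    H x -> ~ small_tail f eps N x -> `|g x - oapp g 0 (y x)| <= e.
Proof.
have [D0|/set0P D0] := eqVneq (derived f eps H) set0.
  exists (fun=> None); split=> // g e cg e0.
  have [|N HN] := @derived_disjoint _ _ f eps eps0 H setT closedT.
    by rewrite D0 => x [].
  by exists N => x Hx []; exact: HN.
have [p [pD pid pc]] :=
  closed_pointwise_retraction (@compact_setT K) (@closed_derived _ _ f eps H) D0.
exists (fun x => Some (p x)); split=> [x z [<-]//|g e cg e0 /=].
(* Since [p] fixes the points of [derived f eps H] and is continuous there, they are interior to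
   [V]; the complement of the interior is a closed set disjoint from them. *)
pose V := [set x | `|g x - g (p x)| < e].
have [||N HN] := @derived_disjoint _ _ f eps eps0 H (~` interior V).
- exact/open_closedC/open_interior.
- move=> z [nV Dz]; apply: nV.
  have : g x - g (p x) @[x --> z] --> g z - g z.
    apply: cvgB; first exact: cg.
    exact: (cvg_comp _ _ (pc z Dz) (cg z)).
  by rewrite subrr => /cvgr0_norm_lt; apply.
exists N => x Hx Nx; apply: ltW; apply: (@interior_subset _ V).
by apply: contrapT => Vx; apply: Nx; exact: HN.
Qed.

End line.

Section null_seminorms.
Context {R : realType} {d : Order.disp_t} {K : compactLineType d}.
Context (F : nat -> contfun R K) (eps B : R).
Hypothesis eps0 : 0 < eps.
Hypothesis FB : forall M x, \sum_(0 <= m < M) `|contfun_val (F m) x| <= B.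

Lemma contfun_cont (g : contfun R K) : continuous (contfun_val g).
Proof. exact/asboolP/contfun_valP. Qed.

Lemma norm_contfun_ge (g : contfun R K) x : `|contfun_val g x| <= `|g|.
Proof. exact: sup_norm_ub (contfun_bounded g). Qed.

Lemma null_seminorms : exists (D : nat) (p : nat -> contfun R K -> R),
  [/\ forall k g h, p k (g + h) <= p k g + p k h,
      forall k a g, p k (a *: g) = `|a| * p k g,
      forall k g, p k g <= 2 * `|g|,
      forall g e, 0 < e -> exists N, forall k, (N <= k)%N -> p k g <= e &
      forall k g b, 0 <= b ->
        (forall x, small_tail (fun m => contfun_val (F m)) eps k x ->
           `|contfun_val g x| <= b) -> `|g| <= b + D%:R * p k g].
Proof.
pose f m := contfun_val (F m); pose St := small_tail f eps.
pose H i := iter i (derived f eps) setT.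
have fc m : continuous (f m) by exact: contfun_cont.
have HB i x M : H i x -> \sum_(0 <= m < M) `|f m x| <= B - i%:R * eps.
  elim: i x M => [|i IH] x M; first by rewrite mul0r subr0 => _; exact: FB.
  by move=> Hx; have := derived_sum_le fc eps0 IH M Hx; rewrite mulrSr; lra.
(* After [D] derivations the bound [B - D eps] is negative, which even the empty sum violates. *)
pose D := (Num.truncn (B / eps)).+1.
have HD : H D = set0.
  apply/seteqP; split=> // x Hx; have := HB _ _ 0%N Hx; rewrite big_geq// => h.
  have : B / eps < D%:R by rewrite /D; apply: truncnS_gt.
  by rewrite ltr_pdivrMr//; lra.
have /choice[y yP] : forall i, exists y : K -> option K,
  (forall x z, y x = Some z -> H i.+1 z) /\
  forall (g : K -> R) (e : R), continuous g -> 0 < e -> exists N, forall x,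
    H i x -> ~ St N x -> `|g x - oapp g 0 (y x)| <= e.
  by move=> i; exact: derived_move.
(* The value 0 at the pairs that are not admissible lets one index set serve all [k], so that [p k]
   is a plain [sup_norm]. *)
pose th k (g : K -> R) (s : 'I_D * K) : R :=
  if `[< H s.1 s.2 /\ ~ St k s.2 >] then g s.2 - oapp g 0 (y s.1 s.2) else 0.
have th_le k g s : `|th k (contfun_val g) s| <= 2 * `|g|.
  rewrite /th; case: ifP => _; last by rewrite normr0 mulr_ge0.
  apply: le_trans (ler_normB _ _) _; rewrite mulr_natl mulr2n lerD//.
    exact: norm_contfun_ge.
  by case: (y _ _) => [z|] /=; [exact: norm_contfun_ge|rewrite normr0].
have th_bnd k g : has_ubound (range (fun s => `|th k (contfun_val g) s|)).
  by exists (2 * `|g|) => _ [s _ <-].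
exists D, (fun k g => sup_norm (th k (contfun_val g))); split.
- move=> k g h; apply: le_trans (sup_normD (th_bnd k g) (th_bnd k h)).
  rewrite (_ : th _ _ = fun s => th k (contfun_val g) s + th k (contfun_val h) s)//.
  apply/funext => s; rewrite /th; case: ifP => _; last by rewrite addr0.
  have E x : contfun_val (g + h) x = contfun_val g x + contfun_val h x by [].
  by case: (y _ _) => [z|]; rewrite /oapp !E; ring.
- move=> k a g; rewrite -(sup_normZ _ (th_bnd k g)).
  congr sup_norm; apply/funext => s; rewrite /th; case: ifP => _; last by rewrite mulr0.
  have E x : contfun_val (a *: g) x = a * contfun_val g x by [].
  by case: (y _ _) => [z|]; rewrite /oapp !E; ring.
- by move=> k g; apply: sup_norm_le => //; rewrite mulr_ge0.
- move=> g e e0.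
  have /choice[N NP] : forall i, exists N, forall x, H i x -> ~ St N x ->
      `|contfun_val g x - oapp (contfun_val g) 0 (y i x)| <= e.
    by move=> i; apply: (yP i).2 => //; exact: contfun_cont.
  exists (\max_(i < D) N i) => k Nk; apply: sup_norm_le; first exact: ltW.
  move=> [i x]; rewrite /th; case: asboolP => [[/= Hx kx]|_]; last by rewrite normr0 ltW.
  apply: NP => // Nx; apply: kx; apply: small_tailS Nx => //.
  by apply: leq_trans Nk; exact: (leq_bigmax i).
move=> k g b b0 gb; set p := sup_norm _.
have p0 : 0 <= p by exact: sup_norm_ge0.
(* Induction on the number [j] of derivations left before the empty set. A point with small tail is
   bounded by [b]; any other moves one level down at cost [p], or, when the next set is empty,
   already has value at most [p]. *)
have step j x : (j <= D)%N -> H (D - j)%N x -> `|contfun_val g x| <= b + j%:R * p.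
  elim: j x => [|j IH] x; first by rewrite subn0 HD.
  move=> jD Hx; have [kx|kx] := pselect (St k x).
    by apply: le_trans (gb _ kx) _; rewrite lerDl mulr_ge0.
  have iD : (D - j.+1 < D)%N by rewrite ltn_subrL.
  have := @sup_norm_ub _ _ (th k (contfun_val g)) (Ordinal iD, x) (th_bnd _ _).
  rewrite -/p /th asboolT//= mulrSr.
  have := (yP (D - j.+1)%N).1 x; case: (y _ x) => [z /(_ z erefl)|_] /= h.
    have {h} : H (D - j)%N z by rewrite -subnSK.
    move=> /(IH z (ltnW jD)) hz; have := ler_normD (contfun_val g x - contfun_val g z) (contfun_val g z).
    by rewrite subrK; lra.
  have : 0 <= j%:R * p by rewrite mulr_ge0.
  by move: h; rewrite subr0; lra.
apply: sup_norm_le; first by rewrite addr_ge0 ?mulr_ge0.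
by move=> x; apply: step => //; rewrite subnn.
Qed.
End null_seminorms.

(** * Coordinates in the space of null sequences *)

Section c0_coordinates.
Context {R : realType}.
Implicit Types (a : c0space R) (k m n M : nat).

Lemma c0_cvg a : c0space_val a @ \oo --> (0 : R).
Proof. by case: a => u /= /asboolP. Qed.

Lemma c0_coord_le a n : `|c0space_val a n| <= `|a|.
Proof. exact: sup_norm_ub (c0space_bounded a). Qed.

Fact c0_tail_subproof a k :
  c0space_pred (fun n => if (n < k)%N then 0 else c0space_val a n).
Proof.
apply/asboolP; apply: cvg_trans (c0_cvg a); apply: near_eq_cvg.
by exists k => // n /= kn; rewrite ltnNge kn.
Qed.

Definition c0_tail k a := C0Space (c0_tail_subproof a k).

Fact c0_unit_subproof m : c0space_pred (fun n => (n == m)%:R : R).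
Proof.
apply/asboolP; apply: (@cvg_trans _ ((fun=> 0 : R) @ \oo)); last exact: cvg_cst.
by apply: near_eq_cvg; exists m.+1 => // n /= mn; rewrite gtn_eqF.
Qed.

Definition c0_unit m := C0Space (c0_unit_subproof m).

Lemma c0_tail_small a (e : R) : 0 < e -> exists M, `|c0_tail M a| <= e.
Proof.
move=> e0; have /cvgr0_norm_le/(_ e e0)[M _ MP] := c0_cvg a.
exists M; apply: sup_norm_le => [|n /=]; first exact: ltW.
by case: ltnP => [_|/MP//]; rewrite normr0 ltW.
Qed.

Lemma c0_val_sum M (u : nat -> c0space R) n :
  c0space_val (\sum_(0 <= m < M) u m) n = \sum_(0 <= m < M) c0space_val (u m) n.
Proof.
elim: M => [|M IH]; first by rewrite !big_nil.
by rewrite !big_nat_recr//= -IH.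
Qed.

Lemma c0_val_comb M (u : nat -> R) n :
  c0space_val (\sum_(0 <= m < M) u m *: c0_unit m) n = if (n < M)%N then u n else 0.
Proof.
rewrite c0_val_sum (eq_bigr (fun m => if m == n then u n else 0)); last first.
  move=> m _; transitivity (u m * (n == m)%:R) => //; rewrite (eq_sym n).
  by case: eqVneq => [->|_]; rewrite ?mulr1 ?mulr0.
by rewrite -big_mkcond big_nat1_eq.
Qed.

Lemma c0_headE k a :
  a - c0_tail k a = \sum_(0 <= m < k) c0space_val a m *: c0_unit m.
Proof.
apply: val_inj; apply/funext => n; rewrite [RHS]c0_val_comb.
have -> : val (a - c0_tail k a) n =
  c0space_val a n - (if (n < k)%N then 0 else c0space_val a n) by [].
by case: ifP => _; rewrite ?subr0 ?subrr.
Qed.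

Lemma c0_norm_le a (b : R) : 0 <= b -> (forall n, `|c0space_val a n| <= b) -> `|a| <= b.
Proof. exact: sup_norm_le. Qed.

Lemma c0_bound_ge0 (X : normedModType R) (T : c0space R -> X) (C : R) :
  (forall a, `|T a| <= C * `|a|) -> 0 <= C.
Proof.
move=> TC; have h1 := c0_coord_le (c0_unit 0) 0; rewrite /= normr1 in h1.
have h0 := le_trans (normr_ge0 _) (TC (c0_unit 0)).
by rewrite -(pmulr_lge0 C (lt_le_trans ltr01 h1)).
Qed.

End c0_coordinates.

(** * Images of null sequences in [C(K)] *)

Section c0_contfun.
Context {R : realType} {K : compactTopologicalType} (T : {linear c0space R -> contfun R K}).
Context (C : R).
Hypothesis TC : forall a, `|T a| <= C * `|a|.

Let val_sum M (u : nat -> contfun R K) x :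
  contfun_val (\sum_(0 <= m < M) u m) x = \sum_(0 <= m < M) contfun_val (u m) x.
Proof.
elim: M => [|M IH]; first by rewrite !big_nil.
by rewrite !big_nat_recr//= -IH.
Qed.

Let T_sum M (u : nat -> R) x :
  contfun_val (T (\sum_(0 <= m < M) u m *: c0_unit m)) x =
  \sum_(0 <= m < M) u m * contfun_val (T (c0_unit m)) x.
Proof.
rewrite linear_sum val_sum; apply: eq_bigr => m _.
by rewrite linearZ.
Qed.

(** Choosing the signs of the [T (c0_unit m)] at [x] as coefficients gives a vector of norm at most
    1 whose image takes the value of this sum at [x]. *)
Lemma c0_image_sum_le M x :
  \sum_(0 <= m < M) `|contfun_val (T (c0_unit m)) x| <= C.
Proof.
pose s m := Num.sg (contfun_val (T (c0_unit m)) x).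
pose a : c0space R := \sum_(0 <= m < M) s m *: c0_unit m.
have a1 : `|a| <= 1.
  apply: c0_norm_le => // n; rewrite c0_val_comb; case: ifP => _; last by rewrite normr0.
  by rewrite normr_sg; case: eqP.
rewrite (eq_bigr (fun m => s m * contfun_val (T (c0_unit m)) x)); last first.
  by move=> m _; rewrite -normrEsg.
rewrite -T_sum -/a; apply: le_trans (ler_norm _) _.
apply: le_trans (sup_norm_ub x (contfun_bounded (T a))) _.
by apply: le_trans (TC a) _; rewrite ler_piMr ?(c0_bound_ge0 TC).
Qed.

(** Truncating [a] far out costs arbitrarily little, and the image of the truncation at [x] is a
    finite sum over indices from [k] on, with coefficients at most [|a|]. *)
Lemma c0_image_small eps k x a : 0 < eps ->
  small_tail (fun m => contfun_val (T (c0_unit m))) eps k x ->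
  (forall m, (m < k)%N -> c0space_val a m = 0) ->
  `|contfun_val (T a) x| <= eps * `|a|.
Proof.
move=> eps0 kx ak; apply/ler_addgt0Pr => e e0.
have C0 := c0_bound_ge0 TC.
(* The tail has norm at most [e / (C + 1)], so its image has norm at most [e], also when [C = 0]. *)
have [M aM] := c0_tail_small a (divr_gt0 e0 (ltr_wpDl C0 ltr01)).
have -> : contfun_val (T a) x =
    contfun_val (T (a - c0_tail M a)) x + contfun_val (T (c0_tail M a)) x.
  by rewrite -{1}(subrK (c0_tail M a) a) raddfD.
apply: le_trans (ler_normD _ _) _; apply: lerD; last first.
  apply: le_trans (sup_norm_ub x (contfun_bounded _)) _.
  apply: le_trans (TC _) _; apply: le_trans (ler_wpM2l C0 aM) _.
  by rewrite mulrA ler_pdivrMr ?ltr_wpDl// mulrDr mulr1 mulrC lerDl ltW.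
rewrite c0_headE T_sum.
have -> : \sum_(0 <= m < M) c0space_val a m * contfun_val (T (c0_unit m)) x =
          \sum_(k <= m < M) c0space_val a m * contfun_val (T (c0_unit m)) x.
  have [kM|/ltnW Mk] := leqP k M.
    rewrite (big_cat_nat _ kM)//= big_nat big1 ?add0r// => m /andP[_ mk].
    by rewrite ak ?mul0r.
  rewrite [RHS]big_geq// big_nat big1// => m /andP[_ mM].
  by rewrite ak ?mul0r// (leq_trans mM).
apply: le_trans (ler_norm_sum _ _ _) _.
rewrite mulrC; apply: le_trans (ler_wpM2l (normr_ge0 a) (kx M)).
rewrite mulr_sumr; apply: ler_sum => m _.
by rewrite normrM ler_wpM2r// c0_coord_le.
Qed.

End c0_contfun.

(** * Extending the coordinates *)

Section c0_projection.
Context {R : realType} {X : normedModType R} (T : {linear c0space R -> X}).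
Context (C c D : R) (p : nat -> X -> R).
Hypotheses (c0 : 0 < c) (D0 : 0 < D).
Hypothesis TC : forall a, `|T a| <= C * `|a|.
Hypothesis Tc : forall a, c * `|a| <= `|T a|.
Hypothesis p_subadd : forall k x y, p k (x + y) <= p k x + p k y.
Hypothesis p_homog : forall k (t : R) x, p k (t *: x) = `|t| * p k x.
Hypothesis p_le : forall k x, p k x <= 2 * `|x|.
Hypothesis p_null : forall x (e : R), 0 < e ->
  exists N, forall k, (N <= k)%N -> p k x <= e.
Hypothesis p_c0 : forall k a, (forall m, (m < k)%N -> c0space_val a m = 0) ->
  `|a| <= D * p k (T a).

Let p_ge0 k x : 0 <= p k x.
Proof. exact: (seminorm_ge0 (p_subadd k) (p_homog k)). Qed.

Let C_ge0 : 0 <= C := c0_bound_ge0 TC.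

(* Two points of the unit ball of [c0] whose first [k] coordinates and whose
   values of [p k \o T] nearly agree differ in norm by about [2 D p k (T a)],
   and finitely many points suffice to approximate the whole ball this way. *)
Lemma c0_coord_le_seminorm k (delta : R) : 0 < delta -> exists n0, forall n, (n0 <= n)%N ->
  forall a, `|c0space_val a n| <= 2 * D * p k (T a) + delta * `|a|.
Proof.
move=> delta0.
have C1 : 0 < 1 + 2 * C by have := C_ge0; lra.
have DC : 0 < D * (1 + 2 * C) by rewrite mulr_gt0.
(* The mesh [e] makes the net error [delta / 2]; the other half is left for the coordinate of the
   net point. *)
have [e e0 eE] : exists2 e, 0 < e & D * (1 + 2 * C) * e = delta / 2.
  exists (delta / 2 / (D * (1 + 2 * C))); first by rewrite !divr_gt0.
  by rewrite mulrC divfK ?gt_eqF.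
(* [None] stands for the seminorm and [Some i] for a coordinate. On the unit ball all these values
   lie in [[-1, 1 + 2 C]], an interval of length [L], which is cut into cells of length [e]. *)
pose phi a (o : option 'I_k) := oapp (fun i : 'I_k => c0space_val a i) (p k (T a)) o.
pose L := 2 + 2 * C.
pose M := Num.truncn (L / e).
pose cell a : {ffun option 'I_k -> 'I_M.+1} :=
  [ffun o => inord (Num.truncn ((phi a o + 1) / e))].
have phi_bnd a o : `|a| <= 1 -> -1 <= phi a o <= 1 + 2 * C.
  move=> a1; case: o => [i|] /=.
    have := le_trans (c0_coord_le a i) a1; rewrite ler_norml => /andP[-> h] /=.
    by have := C_ge0; lra.
  have := p_ge0 k (T a); have := p_le k (T a); have := TC a.
  have := ler_wpM2l C_ge0 a1; lra.
have cell_close a b o : `|a| <= 1 -> `|b| <= 1 -> cell a = cell b ->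
    `|phi a o - phi b o| <= e.
  move=> a1 b1 /ffunP/(_ o); rewrite !ffunE => /(congr1 val) /=.
  have bnd z : `|z| <= 1 -> 0 <= (phi z o + 1) / e /\
      (Num.truncn ((phi z o + 1) / e) < M.+1)%N.
    move=> /(phi_bnd _ o)/andP[l u]; split; first by rewrite divr_ge0 ?(ltW e0)//; lra.
    rewrite ltnS; apply: le_truncn; rewrite ler_pM2r ?invr_gt0// /L; lra.
  have [[a0 ?] [b0 ?]] := (bnd _ a1, bnd _ b1).
  rewrite !inordK// => ab.
  have := truncn_itv a0; have := truncn_itv b0; rewrite ab.
  set t := (Num.truncn _)%:R; rewrite -!natr1 -/t.
  rewrite !ler_pdivlMr// !ltr_pdivrMr// => /andP[? ?] /andP[? ?].
  by rewrite ler_norml; apply/andP; split; lra.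
have /choice[n0 n0P] : forall s, exists n0, forall n, (n0 <= n)%N -> forall a,
    `|a| <= 1 -> cell a = s -> `|c0space_val a n| <= 2 * D * p k (T a) + delta.
  move=> s; have [[b [b1 bs]]|nb] := pselect (exists b, `|b| <= 1 /\ cell b = s); last first.
    by exists 0%N => n _ a a1 ac; exfalso; apply: nb; exists a.
  have /cvgr0_norm_le/(_ (delta / 2))[|N _ NP] := c0_cvg b; first by rewrite divr_gt0.
  exists (maxn N k) => n; rewrite geq_max => /andP[Nn kn] a a1 ac.
  have close o : `|phi a o - phi b o| <= e by apply: cell_close; rewrite // ac bs.
  (* The head [l] has norm at most [e], and [p_c0] applies to [h], which agrees with [a - b] at
     [n]. *)
  pose u := a - b; pose h := c0_tail k u; pose l := u - h.
  have hk m : (m < k)%N -> c0space_val h m = 0 by move=> mk; rewrite /= mk.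
  have le_l : `|l| <= e.
    apply: c0_norm_le => [|m]; first exact: ltW.
    rewrite /l c0_headE c0_val_comb; case: ifP => [mk|_]; last by rewrite normr0 ltW.
    exact: (close (Some (Ordinal mk))).
  have hn : c0space_val h n = c0space_val a n - c0space_val b n.
    by rewrite /= ltnNge kn.
  have := c0_coord_le h n; rewrite hn => h1.
  have := p_c0 hk => h2.
  have h3 : p k (T h) <= p k (T a) + p k (T b) + 2 * (C * e).
    have -> : T h = T (a - b - l) by congr (T _); rewrite /l opprB addrC subrK.
    have -> v : T (a - b - v) = T a + (-1 *: T b + -1 *: T v).
      by rewrite !raddfB/= !scaleN1r addrA.
    have := p_subadd k (T a) (-1 *: T b + -1 *: T l).
    have := p_subadd k (-1 *: T b) (-1 *: T l).
    rewrite !p_homog normrN1 !mul1r.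
    have := p_le k (T l); have := TC l; have := ler_wpM2l C_ge0 le_l; lra.
  have h4 := close None; rewrite /= ler_norml in h4; case/andP: h4 => h4 _.
  have h5 := NP n Nn; have h6 := ler_normD (c0space_val a n - c0space_val b n) (c0space_val b n).
  rewrite subrK in h6.
  have h7 : D * p k (T h) <= D * (2 * p k (T a) + (1 + 2 * C) * e).
    by rewrite ler_pM2l//; lra.
  by rewrite mulrDr mulrA [X in _ + X]mulrA eE in h7; lra.
exists (\max_s n0 s) => n nn a.
have [->|a0] := eqVneq a 0.
  rewrite (_ : c0space_val 0 n = 0)// !normr0 mulr0 addr0.
  by rewrite !mulr_ge0// ltW.
have na : 0 < `|a| by rewrite normr_gt0.
have := n0P (cell (`|a|^-1 *: a)) n (leq_trans (leq_bigmax _) nn) (`|a|^-1 *: a).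
rewrite normrZ normfV normr_id mulVf ?gt_eqF// => /(_ (lexx _) erefl).
rewrite (_ : c0space_val (`|a|^-1 *: a) n = `|a|^-1 * c0space_val a n)//.
rewrite linearZ/= p_homog normrM !normfV !normr_id -(ler_pM2l na) mulVKf ?gt_eqF//.
rewrite mulrDr [2 * D * _]mulrCA mulVKf ?gt_eqF//; lra.
Qed.

Theorem c0_range_complemented : complemented (range T).
Proof.
(* This is the bound of [c0_coord_le_seminorm] for [delta = 1 / (k + 1)], with [|a|] replaced by
   [|T a| / c] so as to make sense on all of [X]. *)
pose r k x := 2 * D * p k x + k.+1%:R^-1 / c * `|x|.
have cV : 0 < c^-1 by rewrite invr_gt0.
have k1 k : 0 < (k.+1%:R^-1 : R) <= 1.
  by rewrite invr_gt0 ltr0n /= invf_le1 ?ltr0n// ler1n.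
have r_subadd k x y : r k (x + y) <= r k x + r k y.
  rewrite /r addrACA -!mulrDr lerD// ler_wpM2l ?p_subadd ?ler_normD//.
    by rewrite mulr_ge0// ltW.
  by rewrite mulr_ge0 ?(ltW cV)//; case/andP: (k1 k) => /ltW.
have r_homog k (t : R) x : r k (t *: x) = `|t| * r k x.
  by rewrite /r p_homog normrZ; ring.
pose good k n := `[< forall a, `|c0space_val a n| <= r k (T a) >].
(* By [p_c0] with no vanishing condition; this makes the maximum defining [kn] range over a nonempty
   set. *)
have good0 n : good 0%N n.
  apply/asboolP => a; apply: le_trans (c0_coord_le a n) _.
  have h : `|a| <= D * p 0%N (T a) by exact: p_c0.
  have : 0 <= (1%:R^-1 / c) * `|T a| by rewrite !mulr_ge0// ?ltW ?invr_gt0.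
  rewrite /r; have := normr_ge0 a; lra.
have goodn k : exists n0, forall n, (n0 <= n)%N -> good k n.
  have /andP[k0 _] := k1 k.
  have [n0 n0P] := c0_coord_le_seminorm k k0.
  exists n0 => n /n0P h; apply/asboolP => a; apply: le_trans (h a) _.
  by rewrite lerD2l -mulrA ler_pM2l// ler_pdivlMl.
(* The largest good order up to [n]. Each order is good for all large [n], so [kn n] tends to
   infinity. *)
pose kn n : 'I_n.+1 := [arg max_(i > ord0 | good i n) i].
have kn_good n : good (kn n) n by rewrite /kn; case: arg_maxnP.
have kn_ge k : exists n0, forall n, (n0 <= n)%N -> (k <= kn n)%N.
  have [n0 n0P] := goodn k; exists (maxn n0 k) => n; rewrite geq_max => /andP[nn kk].
  rewrite /kn; case: arg_maxnP => //= i _; have kk' : (k < n.+1)%N by [].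
  by move=> /(_ (Ordinal kk')); apply; exact: n0P.
have /choice[nu nuP] : forall n, exists g : {scalar X},
    (forall a, g (T a) = c0space_val a n) /\ (forall x, `|g x| <= r (kn n) x).
  move=> n; pose phiL := GRing.isLinear.Build R (c0space R) R *%R
    (fun a => c0space_val a n) (fun _ _ _ => erefl).
  pose phi : {scalar c0space R} := HB.pack (fun a : c0space R => c0space_val a n) phiL.
  have [||a|g [gT gr]] := @hahn_banach _ _ (r (kn n)) _ _ _ T phi.
  - exact: r_subadd.
  - by move=> t x t0; rewrite r_homog ger0_norm.
  - exact: le_trans (ler_norm _) ((asboolW (kn_good n)) a).
  exists g; split=> [a|x]; first exact: gT.
  rewrite ler_norml gr andbT lerNl -raddfN; apply: le_trans (gr _) _.
  by rewrite -scaleN1r r_homog normrN1 mul1r.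
have nu0 x : c0space_pred (fun n => nu n x).
  apply/asboolP; apply/cvgr0Pnorm_le => e e0.
  have [N1 N1P] := p_null x (divr_gt0 (divr_gt0 e0 (ltr0n _ 2)) (mulr_gt0 (ltr0n _ 2) D0)).
  pose N2 := Num.truncn (`|x| / c / (e / 2)).
  have [n0 n0P] := kn_ge (maxn N1 N2).
  exists n0 => // n /= /n0P; rewrite geq_max => /andP[h1 h2].
  apply: le_trans ((nuP n).2 x) _; rewrite /r.
  have e2 : 0 < e / 2 by rewrite divr_gt0.
  have := N1P _ h1; rewrite ler_pdivlMr ?mulr_gt0// => h3.
  have h4 : (kn n).+1%:R^-1 / c * `|x| <= e / 2.
    rewrite -mulrA ler_pdivrMl ?ltr0n// -ler_pdivrMr// (mulrC c^-1); apply: ltW.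
    by apply: lt_le_trans (truncnS_gt _) _; rewrite ler_nat.
  by rewrite [leRHS]splitr lerD// mulrC.
pose Q x := C0Space (nu0 x).
have Plin : linear (T \o Q).
  move=> t x y /=; rewrite -linearP; congr (T _); apply: val_inj; apply/funext => n.
  by rewrite /= linearP.
pose PL := GRing.isLinear.Build R X X *:%R (T \o Q) Plin.
pose P : {linear X -> X} := HB.pack (T \o Q) PL.
have QT a : Q (T a) = a.
  by apply: val_inj; apply/funext => n; exact: (nuP n).1.
exists P; split.
(* From [p k x <= 2 |x|] and [1 / (k + 1) <= 1], every [r k x] is at most [(4 D + 1 / c) |x|]. *)
- exists (C * (4 * D + c^-1)) => x.
  apply: le_trans (TC _) _; rewrite -mulrA ler_wpM2l//.
  apply: c0_norm_le => [|n]; first by rewrite mulr_ge0// addr_ge0 ?mulr_ge0// ltW.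
  apply: le_trans ((nuP n).2 x) _; rewrite /r.
  rewrite [leRHS]mulrDl lerD//.
    have : 2 * D * p (kn n) x <= 2 * D * (2 * `|x|) by rewrite ler_pM2l ?mulr_gt0.
    by move=> /le_trans; apply; lra.
  rewrite -mulrA; apply: ler_piMl; first exact: mulr_ge0 (ltW cV) (normr_ge0 _).
  by case/andP: (k1 (kn n)).
- by move=> x; rewrite /= QT.
- apply/seteqP; split=> [_ [x _ <-]|_ [a _ <-]]; first by exists (Q x).
  by exists (T a) => //=; rewrite QT.
Qed.

End c0_projection.

(** * Subspaces of [C(K)] isomorphic to [c_0] *)

Theorem corollary2p5 (R : realType) (d : Order.disp_t) (K : compactLineType d) :
  sobczyk_property (contfun R K).
Proof.
move=> Y _ [T [g [<- gK cT cg]]].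
have [C C0 TC] : exists2 C : R, 0 < C & forall a, `|T a| <= C * `|a|.
  have /linear_boundedP TB := @continuous_linear_bounded _ _ _ 0 T (cT 0).
  near +oo_R => C; exists C; near: C; first exact: nbhs_pinfty_gt.
  exact: TB.
(* Continuity of [g] at 0 within the range gives a radius below which [|g| < 1]; a unit vector with
   a smaller image would contradict this. *)
have [c c0 Tc] : exists2 c : R, 0 < c & forall a, c * `|a| <= `|T a|.
  have T0 : T 0 = 0 by rewrite linear0.
  have g0 : g 0 = 0 by rewrite -{1}T0 gK.
  have : g x @[x --> within (range T) (nbhs 0)] --> (0 : c0space R).
    by rewrite -[X in _ --> X]g0; move/subspace_continuousP: cg; apply; exists 0.
  move=> /cvgr0_norm_lt/(_ 1 ltr01).
  move=> /nbhs_norm0P[c /= c0 cP]; exists (c / 2); first by rewrite divr_gt0.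
  move=> a; have [->|a0] := eqVneq a 0; first by rewrite normr0 mulr0.
  have na : 0 < `|a| by rewrite normr_gt0.
  rewrite leNgt; apply/negP => Ta.
  have := cP (T (`|a|^-1 *: a)); rewrite /= gK normrZ normfV normr_id mulVf ?gt_eqF//.
  rewrite ltxx => h; suff : false by []; apply: h; last by exists (`|a|^-1 *: a).
  rewrite linearZ normrZ normfV normr_id ltr_pdivrMl// mulrC; apply: lt_trans Ta _.
  by rewrite ltr_pM2r// ltr_pdivrMr// mulr_natr mulr2n ltrDl.
(* With [eps = c / 2], the small-tail points account for at most half of the lower bound [c |a|] on
   [|T a|], and the seminorm controls the other half. *)
have eps0 : 0 < c / 2 by rewrite divr_gt0.
have [D [p [pD pZ p_le p_null p_ctl]]] :=
  null_seminorms eps0 (fun M x => c0_image_sum_le TC M x).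
(* [D.+1] instead of [D] makes the constant positive. *)
apply: (@c0_range_complemented _ _ T C c ((D.+1)%:R * (2 / c)) p) => //.
  by rewrite mulr_gt0 ?ltr0n ?divr_gt0.
move=> k a ak; have pk0 := seminorm_ge0 (pD k) (pZ k) (T a).
have b0 : 0 <= c / 2 * `|a| by rewrite mulr_ge0// ltW.
have h := p_ctl k (T a) _ b0 (fun x kx => c0_image_small TC eps0 kx ak).
have h' : c / 2 * `|a| <= D.+1%:R * p k (T a).
  have := le_trans (Tc a) h; rewrite {1}[c]splitr mulrDl lerD2l => /le_trans; apply.
  by rewrite ler_wpM2r// ler_nat.
by rewrite mulrAC -ler_pdivrMr ?divr_gt0// invf_div mulrC.
Unshelve. all: by end_near. Qed.
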